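(* Let $a_0,\dots,a_n\in\mathbb C$ with $a_0\ne 0$ and let $T=a_0I+a_1D+\cdots+a_nD^n$. Let $\gamma_1,\dots,\gamma_n$ be the roots of $a_0z^n+a_1z^{n-1}+\cdots+a_{n-1}z+a_n$, counted with multiplicity. Then $\deg(Tf)=\deg f$ for all $f\in\mathcal P_n$ and $$K_h(T)\le n\sum_{j=1}^n|\gamma_j|,\qquad K_H(T)\le n\sum_{j=1}^n|\gamma_j|,\qquad K_F(T)\le n^2\sum_{j=1}^n|\gamma_j|.$$
   Context: Let $n\ge 1$ be an integer and $\mathcal P_n$ the complex vector space of polynomials in one complex variable of degree at most $n$; $D$ is differentiation on $\mathcal P_n$ and $I$ the identity. For a nonzero $f\in\mathcal P_n$, $Z(f)$ denotes the multiset of roots of $f$ (each root listed according to its multiplicity; empty for nonzero constants); $Z(0)=\mathbb C$. Distances: for finite nonempty $A,B\subset\mathbb C$, $d_h(A,B)=\max_{y\in B}\min_{x\in A}|x-y|$, $d_H(A,B)=\max\{d_h(A,B),d_h(B,A)\}$. Conventions: for $d\in\{d_h,d_H\}$, $d(\emptyset,\emptyset)=0$, $d(A,\emptyset)=d(\emptyset,A)=+\infty$ for $A\ne\emptyset$, and $d(A,B)=0$ if one of $A,B$ equals $\mathbb C$ and the other is nonempty. For multisets $U=\{u_1,\dots,u_m\}$, $V=\{v_1,\dots,v_m\}$ of $m$ complex numbers, $d_F(U,V)=\min_{\sigma}\max_{k}|u_k-v_{\sigma(k)}|$, the minimum over permutations $\sigma$ of $\{1,\dots,m\}$. For $T$ a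 linear operator on $\mathcal P_n$: $K_h(T)=\sup_{f\in\mathcal P_n}d_h(Z(f),Z(Tf))$, $K_H(T)=\sup_{f\in\mathcal P_n}d_H(Z(f),Z(Tf))$; and, for $T$ with $\deg(Tf)=\deg f$ for all $f$, $K_F(T)=\sup\{d_F(Z(f),Z(Tf)): f\in\mathcal P_n\text{ nonconstant}\}$. *)

(* Defs.v *)
From HB Require Import structures.
From mathcomp Require Import all_boot all_order all_algebra.
From mathcomp Require Import all_classical all_reals ereal.
From mathcomp Require Import complex.
Set Implicit Arguments. Unset Strict Implicit. Unset Printing Implicit Defensive.
Import Order.TTheory GRing.Theory Num.Theory.
Local Open Scope ring_scope.
Local Open Scope classical_set_scope.

Section Defs.
Variable R : realType.
Local Notation C := R[i].

Definition cabs (z : C) : R := ComplexField.Normc.normc z.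

Definition inPn (n : nat) (f : {poly C}) : Prop := (size f <= n.+1)%N.

Definition Top (n : nat) (a : nat -> C) (f : {poly C}) : {poly C} :=
  \sum_(k < n.+1) a k *: f^`(k).

(* the multiset of roots of a polynomial, as a sequence (defined up to order):
   a sequence s with f = lead_coef f * prod_(z in s) (X - z). *)
Lemma roots_exists (f : {poly C}) :
  exists s : seq C, f == lead_coef f *: \prod_(z <- s) ('X - z%:P).
Proof.
have [->|f0] := eqVneq f 0; first by exists [::]; rewrite lead_coef0 scale0r.
have [s Hs] := closed_field_poly_normal f; by exists s; apply/eqP.
Qed.

Definition rootseq (f : {poly C}) : seq C := xchoose (roots_exists f).

(* Z(f): None stands for the whole plane C (f = 0), Some s for the
   (finite, possibly empty) set of roots listed in s. *)
Definition Zset (f : {poly C}) : option (seq C) :=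
  if f == 0 then None else Some (rootseq f).

(* min_{x in A} |x - y| for a nonempty list A *)
Definition mindist (A : seq C) (y : C) : R :=
  foldr (fun x m => Num.min (cabs (x - y)) m) (cabs (head 0 A - y)) A.

Definition dh_fin (A B : seq C) : \bar R :=
  match A, B with
  | [::], [::] => 0%E
  | [::], _ :: _ => +oo%E
  | _ :: _, [::] => +oo%E
  | _, _ => (\big[Num.max/0]_(y <- B) mindist A y)%:E
  end.

Definition dh (A B : option (seq C)) : \bar R :=
  match A, B with
  | Some A', Some B' => dh_fin A' B'
  | None, None => 0%E
  | None, Some B' => if B' is [::] then +oo%E else 0%E
  | Some A', None => if A' is [::] then +oo%E else 0%E
  end.

Definition dH (A B : option (seq C)) : \bar R := Order.max (dh A B) (dh B A).

Definition maxdiff (U V : seq C) : R :=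
  \big[Num.max/0]_(k < size U) cabs (U`_k - V`_k).

Definition dF (U V : seq C) : R :=
  foldr (fun t m => Num.min (maxdiff U t) m) (maxdiff U V) (permutations V).

Definition Kh (n : nat) (T : {poly C} -> {poly C}) : \bar R :=
  ereal_sup [set dh (Zset f) (Zset (T f)) | f in [set f | inPn n f]].

Definition KH (n : nat) (T : {poly C} -> {poly C}) : \bar R :=
  ereal_sup [set dH (Zset f) (Zset (T f)) | f in [set f | inPn n f]].

Definition KF (n : nat) (T : {poly C} -> {poly C}) : \bar R :=
  ereal_sup [set (dF (rootseq f) (rootseq (T f)))%:E |
              f in [set f | inPn n f /\ (1 < size f)%N]].

End Defs.

(* Main.v *)
(** With [gamma_j] the roots of the symbol, [T = a_0 (I - gamma_1 D) ... (I - gamma_n D)],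
    so all three bounds reduce to a single factor [f |-> f - gamma f'].

    A root [w] of [f - gamma f'] that is not a root of [f] satisfies
    [1 / gamma = f'(w) / f(w) = sum_k 1 / (w - z_k)], hence lies within [n |gamma|] of
    some [z_k]. Conversely [f(z)] is a linear functional of [g = f - gamma f'], and
    Grace's theorem (iterated polar derivatives, Laguerre) shows that it cannot vanish
    when [g] has no root within [n |gamma|] of [z], because the associated polynomial
    [sum_k m^_k gamma^k u^(m-k)], a reversed truncated exponential, has its roots in
    [|u| <= m |gamma|] by Enestrom-Kakeya.

    For the matching distance, Hall's theorem produces, if there is no good matching,
    large sets of roots of [f] and of [g] that are far apart. Both
    [t |-> (1 - t gamma D) f] and [t |-> (1 - t gamma D)^-1 g] keep their roots within
    [n |gamma|] of those of the starting polynomial, so the number of roots in each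
    cluster of discs is constant, and this brings the two sets close together. *)
Require Import Defs.
From HB Require Import structures.
From mathcomp Require Import all_boot all_order all_algebra.
From mathcomp Require Import all_classical all_reals ereal.
From mathcomp Require Import complex.
From mathcomp Require Import ring lra zify.
Set Implicit Arguments. Unset Strict Implicit. Unset Printing Implicit Defensive.
Import Order.TTheory GRing.Theory Num.Theory.
Local Open Scope ring_scope.

(** * Modulus of complex numbers *)

Lemma cabs_ge0 (R : realType) (z : R[i]) : 0 <= cabs z.
Proof. by case: z => a b; exact: sqrtr_ge0. Qed.

Lemma cabs0 (R : realType) : cabs (0 : R[i]) = 0.
Proof. exact: ComplexField.Normc.normc0. Qed.

Lemma cabs1 (R : realType) : cabs (1 : R[i]) = 1.
Proof. exact: ComplexField.Normc.normc1. Qed.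

Lemma cabsM (R : realType) (x y : R[i]) : cabs (x * y) = cabs x * cabs y.
Proof. exact: ComplexField.Normc.normcM. Qed.

Lemma cabsV (R : realType) (x : R[i]) : cabs x^-1 = (cabs x)^-1.
Proof. exact: ComplexField.Normc.normcV. Qed.

Lemma cabsN (R : realType) (x : R[i]) : cabs (- x) = cabs x.
Proof. exact: normcN. Qed.

Lemma cabsD (R : realType) (x y : R[i]) : cabs (x + y) <= cabs x + cabs y.
Proof. exact: le_normcD. Qed.

Lemma cabsC (R : realType) (x y : R[i]) : cabs (x - y) = cabs (y - x).
Proof. by rewrite -cabsN opprB. Qed.

Lemma cabs_eq0 (R : realType) (x : R[i]) : (cabs x == 0) = (x == 0).
Proof.
apply/eqP/eqP => [|->]; last exact: cabs0.
exact: ComplexField.Normc.eq0_normc.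
Qed.

Lemma cabs_gt0 (R : realType) (x : R[i]) : (0 < cabs x) = (x != 0).
Proof. by rewrite lt_def cabs_ge0 andbT cabs_eq0. Qed.

Lemma cabsX (R : realType) (x : R[i]) k : cabs (x ^+ k) = cabs x ^+ k.
Proof. by elim: k => [|k IH]; rewrite ?expr0 ?cabs1 // !exprS cabsM IH. Qed.

Lemma cabs_real (R : realType) (x : R) : 0 <= x -> cabs (x%:C%C) = x.
Proof.
by move=> x0; rewrite /cabs /= expr0n /= addr0 sqrtr_sqr ger0_norm.
Qed.

Lemma cabs_nat (R : realType) k : cabs (k%:R : R[i]) = k%:R.
Proof. by rewrite -(rmorph_nat (real_complex R)) cabs_real // ler0n. Qed.

Lemma cabs_triangle (R : realType) (y x z : R[i]) :
  cabs (x - z) <= cabs (x - y) + cabs (y - z).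
Proof. by rewrite -[x - z](subrKA y) cabsD. Qed.

Lemma cabs_sum (R : realType) (I : Type) (s : seq I) (F : I -> R[i]) :
  cabs (\sum_(i <- s) F i) <= \sum_(i <- s) cabs (F i).
Proof.
elim/big_rec2: _ => [|i x y _ H]; first by rewrite cabs0.
by apply: le_trans (cabsD _ _) _; rewrite lerD2l.
Qed.

Lemma cabs_prod (R : realType) (I : Type) (s : seq I) (F : I -> R[i]) :
  cabs (\prod_(i <- s) F i) = \prod_(i <- s) cabs (F i).
Proof.
by elim/big_rec2: _ => [|i x y _ <-]; rewrite ?cabs1 ?cabsM.
Qed.

Lemma cabs_sqr (R : realType) (z : R[i]) :
  cabs z ^+ 2 = complex.Re z ^+ 2 + complex.Im z ^+ 2.
Proof. by case: z => a b; rewrite /cabs /= sqr_sqrtr // addr_ge0 // sqr_ge0. Qed.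

(** * Root lists of polynomials *)

Lemma rootseqE (R : realType) (f : {poly R[i]}) :
  f = lead_coef f *: \prod_(z <- rootseq f) ('X - z%:P).
Proof. by apply/eqP; exact: (xchooseP (roots_exists f)). Qed.

Lemma mem_rootseq (R : realType) (f : {poly R[i]}) z :
  f != 0 -> (z \in rootseq f) = root f z.
Proof.
move=> f0; rewrite [in RHS](rootseqE f) rootZ ?root_prod_XsubC //.
by rewrite lead_coef_eq0.
Qed.

Lemma size_rootseq (R : realType) (f : {poly R[i]}) :
  f != 0 -> size (rootseq f) = (size f).-1.
Proof.
move=> f0; rewrite [in RHS](rootseqE f) size_scale ?lead_coef_eq0 //.
by rewrite size_prod_XsubC.
Qed.

Lemma rootseqZ (R : realType) (c : R[i]) (f : {poly R[i]}) :
  c != 0 -> rootseq (c *: f) = rootseq f.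
Proof.
move=> c0; apply: eq_xchoose => s /=.
by rewrite lead_coefZ -scalerA; apply/eqP/eqP => [/(scalerI c0) //|{1}-> //].
Qed.

(** * Logarithmic derivative and the forward root estimate *)

Lemma horner_deriv_prod (R : realType) (zs : seq R[i]) (x : R[i]) :
  x \notin zs ->
  (\prod_(z <- zs) ('X - z%:P))^`().[x] =
  (\prod_(z <- zs) ('X - z%:P)).[x] * \sum_(z <- zs) (x - z)^-1.
Proof.
elim: zs => [|z zs IH]; first by rewrite !big_nil derivC horner0 mulr0.
rewrite inE negb_or => /andP[xz xzs].
rewrite !big_cons derivM derivXsubC mul1r hornerD !hornerM IH // hornerXsubC.
have H : x - z != 0 by rewrite subr_eq0.
by rewrite mulrDr mulrAC mulfV // mul1r mulrA.
Qed.

Lemma horner_deriv_rootseq (R : realType) (f : {poly R[i]}) (x : R[i]) :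
  f.[x] != 0 -> f^`().[x] = f.[x] * \sum_(z <- rootseq f) (x - z)^-1.
Proof.
move=> fx.
have f0 : f != 0 by apply: contraNneq fx => ->; rewrite horner0.
rewrite {1 2}(rootseqE f) derivZ !hornerZ horner_deriv_prod ?mulrA //.
by rewrite mem_rootseq.
Qed.

(** The operator $I - gD$; up to the scalar [a 0], [T] is a composition of such factors. *)
Definition subderiv (R : realType) (g : R[i]) (f : {poly R[i]}) : {poly R[i]} :=
  f - g *: f^`().

Lemma subderiv_root_near (R : realType) n (g : R[i]) (f : {poly R[i]}) (w : R[i]) :
  (size f <= n.+1)%N -> f != 0 -> root (subderiv g f) w ->
  exists2 z, root f z & cabs (z - w) <= n%:R * cabs g.
Proof.
move=> sf f0 rw.
have [fw|fw] := eqVneq f.[w] 0.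
  exists w; first exact/rootP.
  by rewrite subrr cabs0 mulr_ge0 ?cabs_ge0.
apply: contrapT => far.
move: rw; rewrite /root /subderiv hornerD hornerN hornerZ horner_deriv_rootseq // => /eqP.
set U := \sum_(_ <- _) _ => E.
have {E}E : 1 = g * U.
  by apply: (mulfI fw); apply/eqP; rewrite mulr1 -subr_eq0 mulrCA E.
have gU : 1 = cabs g * cabs U by rewrite -cabsM -E cabs1.
have g0 : 0 < cabs g.
  rewrite lt_def cabs_ge0 andbT; apply: contra_eq_neq gU => ->.
  by rewrite mul0r oner_eq0.
have U0 : U != 0 by apply: contra_eq_neq gU => ->; rewrite cabs0 mulr0 oner_eq0.
(* For constant [f] the root list is empty, so [U] would vanish. *)
have n0 : (0 < n)%N.
  rewrite lt0n; apply: contra_neq U0 => n0; rewrite /U.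
  have /size0nil -> : size (rootseq f) = 0%N by rewrite size_rootseq //; lia.
  by rewrite big_nil.
have : cabs U < (cabs g)^-1.
  apply: le_lt_trans (cabs_sum _ _) _.
  have L z : z \in rootseq f -> cabs (w - z)^-1 < (n%:R * cabs g)^-1.
    rewrite mem_rootseq // => rz; rewrite cabsV ltf_pV2 ?posrE.
    - by rewrite cabsC ltNge; apply/negP => H; apply: far; exists z.
    - rewrite cabs_gt0 subr_eq0; apply: contraNneq fw => ->; exact/eqP/rootP.
    - by rewrite mulr_gt0 ?ltr0n.
  (* The empty list is treated apart: summing strict bounds stays strict only if there is a term. *)
  case: (rootseq f) (size_rootseq f0) L => [|y s] ss L.
    by rewrite big_nil invr_gt0.
  apply: (@lt_le_trans _ _ (\sum_(z <- y :: s) (n%:R * cabs g)^-1)).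
    rewrite big_cons [ltRHS]big_cons ltr_leD ?L ?mem_head //.
    rewrite [leLHS]big_seq [leRHS]big_seq ler_sum // => z zs.
    by apply/ltW/L; rewrite inE zs orbT.
  rewrite big_const_seq count_predT iter_addr_0 ss -[_ *+ _.-1]mulr_natr invfM.
  rewrite mulrAC ler_piMl ?invr_ge0 ?cabs_ge0 //.
  by rewrite mulrC ler_pdivrMr ?ltr0n // mul1r ler_nat; lia.
by rewrite -(ltr_pM2l g0) -gU mulfV ?ltxx //; exact: lt0r_neq0.
Qed.

(** * Grace's theorem and the converse root estimate *)

(** Missing terms count as [0], and $L(0) = 0 < M$; this serves polynomials of degree below [m]. *)
Lemma additive_sum_lt (R : realType) (V : zmodType) (L : V -> R) (M : R)
    (us : seq V) m :
  L 0 = 0 -> (forall u v, L (u + v) = L u + L v) -> 0 < M ->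
  (forall u, u \in us -> L u < M) -> (size us <= m)%N -> (0 < m)%N ->
  L (\sum_(u <- us) u) < m%:R * M.
Proof.
move=> L0 LD M0; elim: us m => [|u us IH] m Lu.
  by rewrite big_nil L0 => _ m0; rewrite mulr_gt0 ?ltr0n.
case: m => // m /= sm _; rewrite big_cons LD -addn1 natrD mulrDl mul1r addrC.
have Lus v : v \in us -> L v < M by move=> vu; apply: Lu; rewrite inE vu orbT.
have Luu := Lu u (mem_head _ _).
case: m sm => [|m] sm.
  by case: us {IH Lus Lu} sm => // _; rewrite big_nil L0 mul0r !add0r.
by rewrite ltrD // IH.
Qed.

(* The image of the exterior of the disc under [w |-> (x - w)^-1] is convex and
   contains [0]; convexity enters through a supporting real-linear form. *)
Lemma exterior_average (R : realType) (rho : R) (x u0 : R[i]) (us : seq R[i]) m :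
  cabs x <= rho -> (0 < m)%N -> (size us <= m)%N ->
  (forall u, u \in us -> rho * cabs u < cabs (x * u - 1)) ->
  \sum_(u <- us) u = m%:R * u0 ->
  rho * cabs u0 < cabs (x * u0 - 1).
Proof.
move=> xr m0 sm far E.
have rho0 : 0 <= rho := le_trans (cabs_ge0 x) xr.
pose k := rho ^+ 2 - cabs x ^+ 2.
have k0 : 0 <= k by rewrite subr_ge0 ler_sqr ?nnegrE ?cabs_ge0.
(* Squaring turns the condition into a quadratic one, convex in [u] because [k >= 0]. *)
have phi u : (rho * cabs u < cabs (x * u - 1)) =
    (k * cabs u ^+ 2 + 2 * complex.Re (x * u) < 1).
  rewrite -ltr_sqr ?nnegrE ?mulr_ge0 ?cabs_ge0 // exprMn /k !cabs_sqr.
  case: x u {xr k k0 far E} => [a b] [c d] /=.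
  by apply/idP/idP; lra.
rewrite phi.
(* The linear part of the tangent at [u0] to that quadratic; the tangent lies below it since
   $k|u-u_0|^2 \ge 0$. *)
pose L u := 2 * k * (complex.Re u0 * complex.Re u + complex.Im u0 * complex.Im u)
   + 2 * complex.Re (x * u).
have LD u v : L (u + v) = L u + L v.
  rewrite /L [x * _]mulrDr; move: u v (x * u) (x * v) => [? ?] [? ?] [? ?] [? ?] /=.
  ring.
have L0 : L 0 = 0 by rewrite /L mulr0 /= !mulr0 !addr0 mulr0.
have M0 : 0 < 1 + k * cabs u0 ^+ 2.
  by rewrite ltr_pwDl // mulr_ge0 // sqr_ge0.
have LM u : u \in us -> L u < 1 + k * cabs u0 ^+ 2.
  move/far; rewrite phi /L !cabs_sqr.
  set p := complex.Re (x * u); case: u @p => [c d] p.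
  case: u0 {E L LD L0 M0} => e f /= H.
  have := mulr_ge0 k0 (addr_ge0 (sqr_ge0 (c - e)) (sqr_ge0 (d - f))).
  lra.
have := additive_sum_lt L0 LD M0 LM sm m0; rewrite E.
have -> : L (m%:R * u0) = m%:R * L u0.
  elim: (m) => [|j IH]; first by rewrite !mul0r.
  by rewrite -addn1 !natrD !mulrDl !mul1r LD IH.
rewrite ltr_pM2l ?ltr0n // /L !cabs_sqr.
by move=> H; lra.
Qed.

(** Laguerre's theorem. A zero [x] of the polar derivative gives $\sum_w 1/(x-w) = m/(x-\zeta)$ over
    the roots [w] of [g]. So $1/(x-\zeta)$ is an average of the points $1/(x-w)$, padded with zeros,
    and [exterior_average] puts $\zeta$ outside the disc. *)
Lemma laguerre_polar (R : realType) (rho : R) (zeta x : R[i]) (g : {poly R[i]}) m :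
  (size g <= m.+1)%N -> (0 < m)%N -> cabs zeta <= rho -> cabs x <= rho ->
  (forall w, root g w -> rho < cabs w) ->
  (m%:R *: g - ('X - zeta%:P) * g^`()).[x] != 0.
Proof.
move=> sg m0 zr xr far.
have gx : g.[x] != 0 by apply/negP => /far; rewrite ltNge xr.
have g0 : g != 0 by apply: contraNneq gx => ->; rewrite horner0.
have mC : (m%:R : R[i]) != 0 by rewrite pnatr_eq0 -lt0n.
rewrite hornerD hornerN hornerM hornerZ hornerXsubC horner_deriv_rootseq //.
rewrite mulrCA mulrC -mulrBr mulf_eq0 (negPf gx) /= subr_eq0.
apply/eqP => E.
have xz : x - zeta != 0.
  by apply: contra_eq_neq E => ->; rewrite mul0r.
(* For $u = 1/(x-w)$ this turns $\rho|u| < |xu-1|$ into $\rho < |w|$. *)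
have inv w : x - w != 0 -> x * (x - w)^-1 - 1 = w * (x - w)^-1.
  by move=> H; rewrite -[in X in _ - X](mulfV H) -mulrBl subKr.
have H : rho * cabs (x - zeta)^-1 < cabs (x * (x - zeta)^-1 - 1).
  apply: (@exterior_average R rho x (x - zeta)^-1
    [seq (x - w)^-1 | w <- rootseq g] m xr m0).
  - by rewrite size_map size_rootseq //; lia.
  - move=> u /mapP[w wg ->]; have rw : root g w by rewrite -mem_rootseq.
    have xw : x - w != 0 by rewrite subr_eq0; apply: contraNneq gx => ->.
    by rewrite inv // cabsM ltr_pM2r ?far // cabs_gt0 invr_eq0.
  - by rewrite big_map; apply: (mulfI xz); rewrite mulrCA mulfV // mulr1 -E.
by move: H; rewrite inv // cabsM ltr_pM2r ?cabs_gt0 ?invr_eq0 // ltNge zr.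
Qed.

(* The sum is the apolar pairing of [g] with [\prod_(y <- ys) ('X - y%:P)]; taking
   the polar derivative of [g] at [- y] removes the factor of [y]. *)
Lemma grace_functional (R : realType) (rho : R) (ys : seq R[i]) (g : {poly R[i]}) :
  0 <= rho ->
  (forall y, y \in ys -> cabs y <= rho) ->
  (size g <= (size ys).+1)%N ->
  (forall w, root g w -> rho < cabs w) ->
  \sum_(k < (size ys).+1)
     (\prod_(y <- ys) ('X - y%:P))`_(size ys - k) / 'C(size ys, k)%:R * g`_k != 0.
Proof.
move=> rho0; elim: ys g => [|y ys IH] g yr sg far.
  rewrite big_ord1 big_nil coef1 /= bin0 divr1 mul1r -horner_coef0.
  by apply/negP => /far; rewrite cabs0 ltNge rho0.
set m := size ys in IH *.
(* The polar derivative at [- y]. Its coefficient of degree [m.+1] cancels, so the induction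
   hypothesis applies to it. *)
pose A := m.+1%:R *: g - ('X - (- y)%:P) * g^`().
have Ak k : A`_k = (m.+1%:R - k%:R) * g`_k - y * k.+1%:R * g`_k.+1.
  rewrite /A coefB coefZ polyCN opprK mulrDl coefD coefXM coefCM !coef_deriv.
  by case: k => [|k] /=; ring.
have sA : (size A <= m.+1)%N.
  apply/leq_sizeP => k mk; rewrite Ak.
  have -> : g`_k.+1 = 0 by apply: nth_default; apply: leq_trans sg _.
  move: mk; rewrite leq_eqVlt => /orP[/eqP <-|mk]; first by rewrite subrr mul0r mulr0 subr0.
  by rewrite (nth_default _ (leq_trans sg mk)) !mulr0 subr0.
have := IH A _ sA _; rewrite -/m.
have yr' z : z \in ys -> cabs z <= rho.
  by move=> zs; apply: yr; rewrite inE zs orbT.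
have A0 w : root A w -> rho < cabs w.
  move=> rw; rewrite ltNge; apply/negP => wr.
  have := @laguerre_polar R rho (- y) w g m.+1 sg isT _ wr far.
  by rewrite -/A cabsN (eqP rw) eqxx => /(_ (yr _ (mem_head _ _))).
move=> /(_ yr' A0); apply: contra_neq => S0.
(* It remains to see that [m.+1] times the sum for [y :: ys] and [g] is the sum for [ys] and [A].
   [U] and [V] come from the two terms of ['X - y%:P]. *)
rewrite -[RHS](mulr0 m.+1%:R) -[X in _ = _ * X]S0 big_cons mulr_sumr; apply/esym.
set q := \prod_(_ <- _) _.
pose c k : R[i] := q`_(m - k) / 'C(m, k)%:R.
pose U k := (m.+1%:R - k%:R) * c k * g`_k.
pose V k := - y * k%:R * c k.-1 * g`_k.
transitivity (\sum_(k < m.+2) (U k + V k)).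
  apply: eq_bigr => -[k /= km] _; rewrite mulrA /U /V -mulrDl; congr (_ * _).
  rewrite mulrBl coefB coefXM coefCM.
  have C0 j l : (l <= j)%N -> ('C(j, l)%:R : R[i]) != 0.
    by move=> lj; rewrite pnatr_eq0 -lt0n bin_gt0.
  have E1 : (k <= m)%N -> m.+1%:R / 'C(m.+1, k)%:R = (m.+1%:R - k%:R) / 'C(m, k)%:R :> R[i].
    move=> km'; apply/eqP; rewrite eqr_div ?C0 //.
    by rewrite -natrB // -!natrM; apply/eqP; congr _%:R; rewrite mul_bin_down.
  have E2 : (0 < k)%N -> m.+1%:R / 'C(m.+1, k)%:R = k%:R / 'C(m, k.-1)%:R :> R[i].
    move=> k0; have km1 : (k.-1 <= m)%N by lia.
    apply/eqP; rewrite eqr_div ?C0 //.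
    rewrite -!natrM; apply/eqP; congr _%:R.
    by case: (k) k0 => // j _; rewrite mul_bin_diag.
  have -> a b : m.+1%:R * ((a - y * b) / 'C(m.+1, k)%:R) =
     m.+1%:R / 'C(m.+1, k)%:R * a - y * (m.+1%:R / 'C(m.+1, k)%:R * b) :> R[i].
    by ring.
  congr (_ + _).
    have [km'|mk] := leqP k m; last first.
      have -> : k = m.+1 by lia.
      by rewrite subnn mulr0 subrr mul0r.
    rewrite E1 // subn_eq0 leqNgt ltnS km' /= /c.
    by rewrite subSn // mulrA mulrAC.
  case: (posnP k) => [->|k0].
    rewrite subn0 nth_default; first by rewrite !mulr0 mul0r oppr0.
    by rewrite /q size_prod_XsubC.
  rewrite E2 // /c; have -> : (m - k.-1 = m.+1 - k)%N by lia.
  by ring.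
(* [U] vanishes at [k = m.+1] and [V] at [k = 0]; shifting [V] by one index recovers the
   coefficients of [A]. *)
rewrite big_split /= big_ord_recr /= {2}/U subrr !mul0r addr0.
rewrite [X in _ + X]big_ord_recl {1}/V mulr0 !mul0r add0r -big_split /=.
by apply: eq_bigr => k _; rewrite Ak /U /V /bump /= add1n /=; rewrite /c; ring.
Qed.

(** Multiplying by $1-t$ leaves $c_0$ minus $c_m t^{m+1}$ and the terms $(c_k-c_{k+1})t^{k+1}$;
    these have nonnegative weights and total modulus at most $|t|c_0 < c_0$. *)
Lemma enestrom_kakeya (R : realType) (c : nat -> R) (t : R[i]) m :
  (forall k, 0 <= c k) -> (forall k, c k.+1 <= c k) -> 0 < c 0%N -> cabs t < 1 ->
  \sum_(k < m.+1) (c k)%:C%C * t ^+ k != 0.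
Proof.
move=> c0 cS c00 t1.
have H : cabs ((1 - t) * (\sum_(k < m.+1) (c k)%:C%C * t ^+ k)
          - (c 0%N)%:C%C + (c m)%:C%C * t ^+ m.+1) <= cabs t * (c 0%N - c m).
  elim: m => [|m IH].
    rewrite big_ord1 expr0 mulr1 expr1 subrr mulr0.
    have -> : (1 - t) * (c 0%N)%:C%C - (c 0%N)%:C%C + (c 0%N)%:C%C * t = 0 by ring.
    by rewrite cabs0.
  rewrite big_ord_recr /=.
  set S := \sum_(_ < _) _ in IH *.
  have -> : (1 - t) * (S + (c m.+1)%:C%C * t ^+ m.+1) - (c 0%N)%:C%C
       + (c m.+1)%:C%C * t ^+ m.+2 =
     ((1 - t) * S - (c 0%N)%:C%C + (c m)%:C%C * t ^+ m.+1)
      - (c m - c m.+1)%:C%C * t ^+ m.+1.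
    by rewrite rmorphB /= [t ^+ m.+2]exprS; ring.
  apply: le_trans (cabsD _ _) _; rewrite cabsN cabsM cabs_real ?subr_ge0 //.
  have -> : cabs t * (c 0%N - c m.+1) =
    cabs t * (c 0%N - c m) + (c m - c m.+1) * cabs t by ring.
  apply: lerD => //; rewrite ler_wpM2l ?subr_ge0 // cabsX exprS ler_piMr ?cabs_ge0 //.
  by rewrite exprn_ile1 ?cabs_ge0 // ltW.
apply/eqP => E; move: H; rewrite E mulr0 sub0r.
apply/negP; rewrite -ltNge.
have H1 := cabs_triangle ((c m)%:C%C * t ^+ m.+1) ((c 0%N)%:C%C) 0.
have H2 : cabs ((c m)%:C%C * t ^+ m.+1) <= c m * cabs t.
  rewrite cabsM cabs_real // ler_wpM2l // cabsX exprS ler_piMr ?cabs_ge0 //.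
  by rewrite exprn_ile1 ?cabs_ge0 // ltW.
rewrite [- _ + _]addrC cabsC; move: H1 H2; rewrite !subr0 cabs_real ?(ltW c00) // => H1 H2.
have H3 : cabs t * c 0%N < c 0%N by rewrite gtr_pMl.
by rewrite mulrBr; lra.
Qed.

(** Divided by $u^m$, the sum is $\sum_k c_k t^k$ with $t = mg/u$ and [c] nonincreasing; $|u| >
    m|g|$ would mean $|t| < 1$, against [enestrom_kakeya]. *)
Lemma truncated_exp_root_le (R : realType) (g u : R[i]) m :
  \sum_(k < m.+1) (m ^_ k)%:R * g ^+ k * u ^+ (m - k) = 0 ->
  cabs u <= m%:R * cabs g.
Proof.
move=> E; rewrite leNgt; apply/negP => ug.
have u0 : u != 0.
  by rewrite -cabs_gt0; apply: le_lt_trans ug; rewrite mulr_ge0 ?cabs_ge0.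
pose c k : R := (m ^_ k)%:R / m%:R ^+ k.
have [m0|m0] := posnP m.
  by move: E; rewrite m0 big_ord1 ffactn0 !expr0 !mulr1 => /eqP; rewrite oner_eq0.
have mR : (0 : R) < m%:R by rewrite ltr0n.
have mC : (m%:R : R[i]) != 0 by rewrite pnatr_eq0 -lt0n.
have /negP[] : \sum_(k < m.+1) (c k)%:C%C * (m%:R * g / u) ^+ k != 0.
  apply: enestrom_kakeya.
  - by move=> k; rewrite divr_ge0 ?exprn_ge0 ?ler0n.
  - move=> k; rewrite /c exprS invfM mulrA ler_pM2r ?invr_gt0 ?exprn_gt0 //.
    rewrite ler_pdivrMr // -natrM ler_nat ffactnSr leq_mul2l.
    by apply/orP; right; exact: leq_subr.
  - by rewrite /c ffactn0 expr0 divr1.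
  - by rewrite !cabsM cabsV cabs_nat ltr_pdivrMr ?cabs_gt0 // mul1r.
apply/eqP; apply: (mulfI (expf_neq0 m u0)); rewrite mulr0 -[RHS]E mulr_sumr.
apply: eq_bigr => -[k /= km] _.
rewrite /c fmorph_div rmorphXn !rmorph_nat !exprMn exprVn.
rewrite -[in LHS](@subnK k m) // exprD.
have uk := expf_neq0 k u0.
move: (u ^+ k) (g ^+ k) uk => a b a0; rewrite subnK //.
by field; rewrite a0 expf_neq0.
Qed.

(** Moving [z] to the origin makes $F(0) = 0$, while $F(0) = \sum_k k!\,g^k G_k$ is the apolar
    pairing of $G = F - gF'$ with [Q], whose roots lie in $|y| \le m|g|$. If all roots of [G] were
    farther out, [grace_functional] would make the pairing nonzero. *)
Lemma subderiv_root_near_conv (R : realType) n (g : R[i]) (f : {poly R[i]}) (z : R[i]) :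
  (size f <= n.+1)%N -> f != 0 -> root f z ->
  exists2 w, root (subderiv g f) w & cabs (z - w) <= n%:R * cabs g.
Proof.
move=> sf f0 fz; apply: contrapT => far.
pose F := f \Po ('X + z%:P); pose G := subderiv g F.
have GE : G = subderiv g f \Po ('X + z%:P).
  rewrite /G /F /subderiv deriv_comp comp_polyB comp_polyZ derivD derivX derivC addr0.
  by rewrite mulr1.
set m := (size f).-1.
have mn : (m <= n)%N by rewrite /m; lia.
(* Chosen so that $Q_{m-k}/\binom{m}{k} = k!\,g^k$. *)
pose Q : {poly R[i]} := \poly_(i < m.+1) ((m ^_ (m - i))%:R * g ^+ (m - i)).
have Qm : (m ^_ (m - m))%:R * g ^+ (m - m) = 1 :> R[i].
  by rewrite subnn ffactn0 mulr1.
have sQ : size Q = m.+1.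
  by apply: size_poly_eq; rewrite /= Qm oner_eq0.
have Q1 : lead_coef Q = 1 by rewrite lead_coefE sQ coef_poly /= ltnSn Qm.
have Q0 : Q != 0 by rewrite -size_poly_eq0 sQ.
have QE : Q = \prod_(y <- rootseq Q) ('X - y%:P).
  by rewrite {1}(rootseqE Q) Q1 scale1r.
have sy : size (rootseq Q) = m by rewrite size_rootseq // sQ.
have sF : size F = m.+1.
  by rewrite size_comp_poly2 ?size_XaddC // polySpred.
have sG : (size G <= m.+1)%N.
  rewrite (leq_trans (size_polyD _ _)) // geq_max sF leqnn size_polyN.
  apply: leq_trans (size_scale_leq _ _) _.
  by rewrite -sF ltnW // lt_size_deriv // -size_poly_eq0 sF.
have /negP[] : \sum_(k < m.+1) Q`_(m - k) / 'C(m, k)%:R * G`_k != 0.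
  have := @grace_functional R (m%:R * cabs g) (rootseq Q) G.
  rewrite -QE sy; apply=> //.
  - by rewrite mulr_ge0 ?cabs_ge0.
  - move=> y; rewrite mem_rootseq // => /rootP; rewrite horner_poly => E.
    apply: truncated_exp_root_le; rewrite -[RHS]E (reindex_inj rev_ord_inj) /=.
    by apply: eq_bigr => -[k /= km] _; rewrite subSS subKn.
  - move=> w; rewrite GE /root horner_comp [X in _.[X]]hornerD hornerX hornerC => rw; rewrite ltNge.
    apply/negP => wg; apply: far; exists (w + z) => //.
    rewrite cabsC addrK; apply: le_trans wg _.
    by rewrite ler_wpM2r ?cabs_ge0 // ler_nat.
(* The pairing telescopes in [h]; the end terms vanish because $F(0) = 0$ and [F] has degree [m]. *)
pose h k := k`!%:R * g ^+ k * F`_k.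
have F0 : h 0%N = 0.
  by rewrite /h fact0 mulr1 mul1r -horner_coef0 horner_comp !hornerE (eqP fz).
have Fm : h m.+1 = 0 by rewrite /h [F`__]nth_default ?mulr0 // sF.
have hF : h 0%N - h m.+1 = 0 by rewrite F0 Fm subr0.
apply/eqP; rewrite -[RHS]hF; transitivity (\sum_(k < m.+1) (h k - h k.+1)).
  apply: eq_bigr => -[k /= km] _; rewrite coef_poly ltnS leq_subr.
  rewrite subKn // -bin_ffact natrM.
  have C0 : ('C(m, k)%:R : R[i]) != 0 by rewrite pnatr_eq0 -lt0n bin_gt0.
  rewrite /G /subderiv coefB coefZ coef_deriv /h factS natrM exprS.
  by rewrite -[F`_k.+1 *+ _]mulr_natr; field.
rewrite -(big_mkord xpredT (fun k => h k - h k.+1)).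
have := @telescope_sumr _ 0 m.+1 (fun k => - h k) isT.
by rewrite opprK addrC => <-; apply: eq_bigr => k _; rewrite opprK addrC.
Qed.

(** * Matchings *)

(* Rado's proof: shrink the neighbourhoods one element at a time; by
   submodularity of [A |-> #|N(A)|], two distinct elements of some [N x] cannot
   both be indispensable. *)
Lemma hall_marriage (X Y : finType) (N : X -> {set Y}) :
  (forall A : {set X}, (#|A| <= #|\bigcup_(x in A) N x|)%N) ->
  exists f : X -> Y, injective f /\ forall x, f x \in N x.
Proof.
have [s] := ubnP (\sum_x #|N x|); elim: s N => // s IH N Ns hall.
have [/existsP[x /card_gt1P[y1 [y2 [y1x y2x y12]]]]|small] :=
    boolP [exists x, 1 < #|N x|]%N; last first.
  (* Hall's condition on one point makes each [N x] a singleton; on two points it makes these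
     distinct. *)
  have N1 x : exists y, N x = [set y].
    apply/cards1P; rewrite eqn_leq; apply/andP; split.
      by rewrite leqNgt; apply: contraNN small => H; apply/existsP; exists x.
    by have := hall [set x]; rewrite cards1 big_set1.
  have [f fP] := choice N1; exists f; split; last by move=> x; rewrite fP set11.
  move=> x x' ff; apply/eqP/negPn/negP => xx'.
  have := hall [set x; x']; rewrite big_setU1 ?inE //= big_set1 !fP ff finset.setUid.
  by rewrite cards1 cards2 xx'.
pose N' y z := if z == x then N x :\ y else N z.
have shrink y : y \in N x -> (\sum_z #|N' y z| < \sum_z #|N z|)%N.
  move=> yx; rewrite (bigD1 x) //= [ltnRHS](bigD1 x) //= /N' eqxx.
  rewrite (cardsD1 y (N x)) yx add1n ltnS leq_add2l.
  by apply: leq_sum => z /negPf ->.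
have reduce y : y \in N x ->
    (forall A : {set X}, (#|A| <= #|\bigcup_(z in A) N' y z|)%N) ->
    exists f : X -> Y, injective f /\ forall x, f x \in N x.
  move=> yx H; case: (IH (N' y) _ H); first exact: leq_trans (shrink y yx) _.
  move=> f [fi fN]; exists f; split => // z; have := fN z; rewrite /N'.
  by case: eqP => // ->; rewrite inE => /andP[].
(* A set violating the condition for [N' y] must contain [x]; [B] is that set without [x]. *)
have violate y : ~ (forall A : {set X}, (#|A| <= #|\bigcup_(z in A) N' y z|)%N) ->
    exists B : {set X}, x \notin B /\
      (#|(\bigcup_(z in B) N z) :|: (N x :\ y)| <= #|B|)%N.
  move=> /existsNP[A /negP]; rewrite -ltnNge => HA.
  have xA : x \in A.
    apply: contraLR HA => xA; rewrite -leqNgt.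
    rewrite (eq_bigr N) ?hall // => z zA; rewrite /N'.
    by case: eqP => // zx; rewrite -zx zA in xA.
  exists (A :\ x); rewrite !inE eqxx; split => //.
  move: HA; rewrite (cardsD1 x A) xA add1n ltnS (bigD1 x) //= /N' eqxx finset.setUC.
  rewrite (eq_bigr N); last by move=> z /andP[_ /negPf ->].
  by rewrite (eq_bigl (mem (A :\ x))) // => z; rewrite !inE andbC.
have [H|/violate[B1 [xB1 H1]]] :=
  pselect (forall A : {set X}, (#|A| <= #|\bigcup_(z in A) N' y1 z|)%N).
  exact: reduce H.
have [H|/violate[B2 [xB2 H2]]] :=
  pselect (forall A : {set X}, (#|A| <= #|\bigcup_(z in A) N' y2 z|)%N).
  exact: reduce H.
exfalso.
set M1 := _ :|: _ in H1; set M2 := _ :|: _ in H2.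
(* [M1 :|: M2] contains [N x] because [y1 != y2]. Together with [I], this forces $|M_1|+|M_2| >
   |B_1|+|B_2|$. *)
have U : (#|x |: (B1 :|: B2)| <= #|M1 :|: M2|)%N.
  apply: leq_trans (hall _) _; apply/subset_leq_card/bigcupsP => z.
  rewrite !inE => /or3P[/eqP->|zB|zB]; apply/fintype.subsetP => y yz; rewrite !inE.
  - rewrite yz !andbT; case: (eqVneq y y1) => [->|]; last by rewrite !orbT.
    by rewrite y12 !orbT.
  - by apply/orP; left; apply/orP; left; apply/bigcupP; exists z.
  - by apply/orP; right; apply/orP; left; apply/bigcupP; exists z.
have I : (#|B1 :&: B2| <= #|M1 :&: M2|)%N.
  apply: leq_trans (hall _) _; apply/subset_leq_card/bigcupsP => z.
  rewrite inE => /andP[z1 z2]; apply/fintype.subsetP => y yz; rewrite !inE.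
  by apply/andP; split; apply/orP; left; apply/bigcupP; exists z.
have := cardsUI M1 M2; have := cardsUI B1 B2.
move: U; rewrite cardsU1 !inE negb_or xB1 xB2 /=.
by move: H1 H2 I => ? ? ? ? ? ?; lia.
Qed.

(** If there is no matching, [E] violates Hall's condition and [F] is the complement of its
    neighbourhood. *)
Lemma matching_or_obstruction m (e : rel 'I_m) :
  (exists s : 'I_m -> 'I_m, injective s /\ forall i, e i (s i)) \/
  (exists E F : {set 'I_m}, (m < #|E| + #|F|)%N /\
     forall i j, i \in E -> j \in F -> ~~ e i j).
Proof.
pose N i := [set j | e i j].
have [H|/existsNP[E /negP]] :=
  pselect (forall A : {set 'I_m}, (#|A| <= #|\bigcup_(x in A) N x|)%N).
  left; have [f [fi fN]] := hall_marriage H; exists f; split=> // i.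
  by have := fN i; rewrite inE.
rewrite -ltnNge => HE; right; exists E, (~: \bigcup_(x in E) N x).
split.
  by rewrite -[ltnLHS](card_ord m) -(cardsC (\bigcup_(x in E) N x)) ltn_add2r.
move=> i j iE; rewrite inE; apply: contra => eij; apply/bigcupP; exists i => //.
by rewrite inE.
Qed.

(** * Counting roots along a path of polynomials *)

Lemma horner_small (R : realType) (d B : R) (p : {poly R[i]}) (u : R[i]) m :
  0 <= d -> 1 <= B -> (size p <= m.+1)%N -> (forall k, cabs p`_k <= d) ->
  cabs u <= B -> cabs p.[u] <= d * (m.+1%:R * B ^+ m).
Proof.
move=> d0 B1 sp pd uB; rewrite (horner_coef_wide _ sp).
apply: le_trans (cabs_sum _ _) _.
apply: (@le_trans _ _ (\sum_(i < m.+1) d * B ^+ m)).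
  apply: ler_sum => -[k /= km] _; rewrite cabsM cabsX.
  rewrite ler_pM ?exprn_ge0 ?cabs_ge0 //.
  apply: (@le_trans _ _ (B ^+ k)); first by rewrite lerXn2r ?nnegrE ?cabs_ge0 //; lra.
  by rewrite ler_weXn2l.
by rewrite sumr_const card_ord -[_ *+ _]mulr_natl mulrCA.
Qed.

Lemma coef_prod_XsubC_le (R : realType) (B : R) (ws : seq R[i]) k :
  (forall w, w \in ws -> cabs w <= B) ->
  cabs (\prod_(w <- ws) ('X - w%:P))`_k <= (1 + B) ^+ size ws.
Proof.
elim: ws k => [|w ws IH] k wB.
  by rewrite big_nil expr0 coef1; case: (k == _); rewrite ?cabs1 ?cabs0 ?ler01.
have wB' v : v \in ws -> cabs v <= B by move=> vw; rewrite wB // inE vw orbT.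
have B0 : 0 <= B by apply: le_trans (cabs_ge0 w) (wB _ (mem_head _ _)).
rewrite big_cons mulrBl coefB coefXM coefCM exprS mulrDl mul1r.
apply: le_trans (cabsD _ _) _; rewrite cabsN cabsM lerD //.
  case: eqP => _; last exact: IH.
  by rewrite cabs0 exprn_ge0 // addr_ge0.
by rewrite ler_pM ?cabs_ge0 ?IH ?wB ?mem_head.
Qed.

(** Synthetic division: each coefficient of [p] is a coefficient of the product plus [u] times the
    next one of [p], starting from zero above the degree. *)
Lemma deflate_small (R : realType) (d B : R) (p : {poly R[i]}) (u : R[i]) m :
  0 <= d -> 1 <= B -> (size p <= m)%N -> cabs u <= B ->
  (forall k, cabs (('X - u%:P) * p)`_k <= d) ->
  forall k, cabs p`_k <= d * (m%:R * B ^+ m).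
Proof.
move=> d0 B1 sp uB H.
have rec j k : (m <= k + j)%N -> cabs p`_k <= d * (j%:R * B ^+ j).
  elim: j k => [|j IH] k mk.
    rewrite nth_default; first by rewrite cabs0 mul0r mulr0.
    by rewrite addn0 in mk; exact: leq_trans mk.
  have -> : p`_k = (('X - u%:P) * p)`_k.+1 + u * p`_k.+1.
    by rewrite mulrBl coefB coefXM coefCM subrK.
  apply: le_trans (cabsD _ _) _; rewrite cabsM.
  have IH' : cabs p`_k.+1 <= d * (j%:R * B ^+ j) by apply: IH; lia.
  have HB : 1 <= B ^+ j.+1 by rewrite exprn_ege1.
  have -> : d * (j.+1%:R * B ^+ j.+1) = d * B ^+ j.+1 + B * (d * (j%:R * B ^+ j)).
    by rewrite -addn1 natrD exprD expr1; ring.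
  rewrite lerD ?ler_pM ?cabs_ge0 //.
  by apply: le_trans (H _) _; rewrite ler_peMr.
by move=> k; apply: rec; rewrite leq_addl.
Qed.

Lemma root_near_small_value (R : realType) (e : R) (ws : seq R[i]) (u : R[i]) :
  0 <= e -> (0 < size ws)%N ->
  cabs (\prod_(w <- ws) ('X - w%:P)).[u] <= e ^+ size ws ->
  exists2 w, w \in ws & cabs (u - w) <= e.
Proof.
move=> e0; rewrite horner_prod cabs_prod => s0 H.
apply: contrapT => far.
have {}far w : w \in ws -> e < cabs (u - w).
  by move=> ww; rewrite ltNge; apply/negP => L; apply: far; exists w.
suff : e ^+ size ws < \prod_(w <- ws) cabs ('X - w%:P).[u] by rewrite ltNge H.
elim: ws s0 far {H} => // w ws IH _ far.
rewrite big_cons exprS hornerXsubC /=.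
have ew := far w (mem_head _ _).
have {}far v : v \in ws -> e < cabs (u - v) by move=> vw; rewrite far // inE vw orbT.
have [ws0|ws0] := posnP (size ws); last by rewrite ltr_pM ?exprn_ge0 ?IH.
by rewrite (size0nil ws0) big_nil mulr1 expr0 mulr1.
Qed.

(** Continuity of roots, with [d] depending only on [m], [B], [e], so that one step size serves a
    whole path. A root [u] of the first product nearly annihilates the second, hence is close to
    some [w]; both are divided out and induction applies. *)
Lemma count_roots_stable (R : realType) m (B e : R) :
  1 <= B -> 0 < e ->
  exists2 d, 0 < d & forall (A : pred R[i]) (us ws : seq R[i]),
    size us = m -> size ws = m ->
    (forall u, u \in us -> cabs u <= B) -> (forall w, w \in ws -> cabs w <= B) ->
    (forall u w, u \in us -> w \in ws -> cabs (u - w) <= e -> A u = A w) ->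
    (forall k, cabs (\prod_(u <- us) ('X - u%:P) - \prod_(w <- ws) ('X - w%:P))`_k <= d) ->
    count A us = count A ws.
Proof.
move=> B1 e0; elim: m => [|m [d' d'0 IH]].
  by exists 1 => // A us ws /size0nil -> /size0nil ->.
have B0 : 0 < B by lra.
pose K : R := m.+1%:R * B ^+ m.+1.
have K0 : 0 < K by rewrite mulr_gt0 ?exprn_gt0 ?ltr0n.
pose D : R := (1 + B) ^+ m.
have D0 : 0 < D by rewrite exprn_gt0 // addr_gt0.
(* Half of the budget [d']: replacing [u] by [w] changes coefficients by at most [e' * D], and
   deflation multiplies by [K]. *)
pose e' := Num.min e (d' / (2 * K * D)).
have K2 : 0 < 2 * K by apply: mulr_gt0.
have KD : 0 < 2 * K * D by apply: mulr_gt0.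
have e'0 : 0 < e' by rewrite lt_min e0 divr_gt0.
pose K' : R := m.+2%:R * B ^+ m.+1.
have K'0 : 0 < K' by rewrite mulr_gt0 ?exprn_gt0 ?ltr0n.
(* The first bound is the other half of [d']; the second makes $|q(u)| \le e'^{m+1}$. *)
pose d := Num.min (d' / (2 * K)) (e' ^+ m.+1 / K').
have d0 : 0 < d by rewrite lt_min !divr_gt0 ?exprn_gt0.
exists d => // A [//|u us] ws [sus] sws uB wB AE close.
set p := \prod_(_ <- _) _ in close; set q := \prod_(_ <- ws) _ in close.
have pu : p.[u] = 0 by rewrite /p big_cons hornerM hornerXsubC subrr mul0r.
have spq : (size (p - q)%R <= m.+2)%N.
  rewrite (leq_trans (size_polyD _ _)) // geq_max size_polyN !size_prod_XsubC.
  by rewrite /= sus sws leqnn.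
have uB0 := uB u (mem_head _ _).
have qu : cabs q.[u] <= e' ^+ size ws.
  have := horner_small (ltW d0) B1 spq close uB0.
  rewrite hornerD hornerN pu sub0r cabsN sws => /le_trans; apply.
  by rewrite -/K' -ler_pdivlMr // /d ge_min lexx orbT.
have [|w ww uw] := root_near_small_value (ltW e'0) _ qu; first by rewrite sws.
have /permP cw := perm_to_rem ww.
rewrite cw /=; congr (_ + _)%N.
  congr nat_of_bool; apply: AE; rewrite ?mem_head // (le_trans uw) //.
  by rewrite /e' ge_min lexx.
have swr : size (rem w ws) = m by rewrite size_rem // sws.
have wrB v : v \in rem w ws -> cabs v <= B by move/mem_rem; exact: wB.
apply: IH => //.
- by move=> v vus; rewrite uB // inE vus orbT.
- by move=> v v' vus /mem_rem; apply: AE; rewrite inE vus orbT.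
set P := \prod_(_ <- us) _; set Q := \prod_(_ <- rem w ws) _.
have qE : q = ('X - w%:P) * Q.
  by rewrite /q (perm_big _ (perm_to_rem ww)) big_cons.
have dd : 0 <= d + e' * D by rewrite ltW // addr_gt0 // mulr_gt0.
have sPQ : (size (P - Q)%R <= m.+1)%N.
  rewrite (leq_trans (size_polyD _ _)) // geq_max size_polyN !size_prod_XsubC.
  by rewrite sus swr leqnn.
have small k : cabs (('X - u%:P) * (P - Q))`_k <= d + e' * D.
  have -> : ('X - u%:P) * (P - Q) = (p - q) + (u - w)%:P * Q.
    by rewrite qE /p big_cons -/P polyCB; ring.
  rewrite coefD coefCM; apply: le_trans (cabsD _ _) _; rewrite cabsM lerD //.
  by rewrite ler_pM ?cabs_ge0 // /D -swr coef_prod_XsubC_le.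
move=> k; apply: le_trans (deflate_small dd B1 sPQ uB0 small k) _; rewrite -/K.
have h1 : d <= d' / (2 * K) by rewrite /d ge_min lexx.
have h2 : e' * D <= d' / (2 * K).
  have h : e' <= d' / (2 * K * D) by rewrite /e' ge_min lexx orbT.
  apply: le_trans (ler_wpM2r (ltW D0) h) _.
  by rewrite invfM mulrA mulfVK // lt0r_neq0.
rewrite -ler_pdivlMr //; apply: le_trans (lerD h1 h2) _.
by rewrite invfM; lra.
Qed.

Lemma finite_gap (R : realType) (I : finType) (P : pred I) (h : I -> R) :
  (forall i, P i -> 0 < h i) -> exists2 e, 0 < e & forall i, P i -> e < h i.
Proof.
(* Starting the minimum at [1] keeps [M] positive when no index satisfies [P]. *)
move=> h0; pose M := \big[Num.min/1]_(i | P i) h i.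
have M0 : 0 < M by apply: lt_bigmin.
exists (M / 2); first by rewrite divr_gt0.
move=> i Pi; have : M <= h i by apply: bigmin_le_cond.
by lra.
Qed.

(** Polynomial dependence on [t] covers both $(1-tgD)f$ and the finite geometric series for
    $(1-tgD)^{-1}$. *)
Definition poly_path (R : realType) N (c : nat -> {poly R[i]}) (t : R) : {poly R[i]} :=
  \sum_(k < N) (t ^+ k)%:C%C *: c k.

Lemma cabs_sub_real (R : realType) (s t : R) : cabs (s%:C%C - t%:C%C) = `|s - t|.
Proof. by rewrite -rmorphB /cabs /= expr0n /= addr0 sqrtr_sqr. Qed.

Lemma expr_lipschitz (R : realType) (s t : R) k :
  0 <= s <= 1 -> 0 <= t <= 1 -> `|s ^+ k - t ^+ k| <= k%:R * `|s - t|.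
Proof.
move=> /andP[s0 s1] /andP[t0 t1]; elim: k => [|k IH].
  by rewrite !expr0 subrr normr0 mul0r.
have -> : s ^+ k.+1 - t ^+ k.+1 = s * (s ^+ k - t ^+ k) + t ^+ k * (s - t).
  by rewrite !exprS; ring.
rewrite -addn1 natrD mulrDl mul1r.
apply: le_trans (ler_normD _ _) _; rewrite !normrM lerD //.
  apply: le_trans IH; rewrite ler_piMl // ger0_norm //.
by rewrite ler_piMl // ger0_norm ?exprn_ge0 // exprn_ile1.
Qed.

Lemma coef_bounded (R : realType) (p : {poly R[i]}) :
  exists2 M, 0 <= M & forall k, cabs p`_k <= M.
Proof.
exists (\sum_(i < size p) cabs p`_i).
  by apply: sumr_ge0 => i _; exact: cabs_ge0.
move=> k; have [kp|pk] := ltnP k (size p).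
  rewrite (bigD1 (Ordinal kp)) //= lerDl.
  by apply: sumr_ge0 => i _; exact: cabs_ge0.
rewrite nth_default // cabs0.
by apply: sumr_ge0 => i _; exact: cabs_ge0.
Qed.

Lemma poly_path_lipschitz (R : realType) N (c : nat -> {poly R[i]}) :
  exists2 L, 0 <= L & forall s t, 0 <= s <= 1 -> 0 <= t <= 1 ->
    forall k, cabs (poly_path N c s - poly_path N c t)`_k <= L * `|s - t|.
Proof.
elim: N => [|N [L L0 IH]].
  exists 0 => // s t _ _ k.
  by rewrite /poly_path !big_ord0 subrr coef0 cabs0 mul0r.
have [M M0 cM] := coef_bounded (c N).
exists (L + N%:R * M); first by rewrite addr_ge0 ?mulr_ge0 ?ler0n.
move=> s t hs ht k; rewrite /poly_path !big_ord_recr /= -!/(poly_path _ _ _).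
rewrite opprD addrACA -scalerBl coefD coefZ [(L + _) * _]mulrDl.
apply: le_trans (cabsD _ _) _; rewrite lerD ?IH // cabsM cabs_sub_real.
rewrite mulrAC ler_pM ?cabs_ge0 //.
exact: expr_lipschitz.
Qed.

Lemma count_nth (R : realType) (A : pred R[i]) (s : seq R[i]) m :
  size s = m -> count A s = #|[set i : 'I_m | A s`_i]|.
Proof.
move=> <-; rewrite -sum1_count (big_nth 0) big_mkord -sum1_card.
by apply: eq_bigl => i; rewrite inE.
Qed.

(* The discs around [E] stay separated from those around the other roots, so
   the number of roots of [p t] in them cannot jump. *)
Lemma homotopy_count (R : realType) N (c : nat -> {poly R[i]}) m (r : R)
    (E F : {set 'I_m}) :
  let p := poly_path N c in
  0 <= r ->
  (forall t, 0 <= t <= 1 -> lead_coef (p t) = 1 /\ size (p t) = m.+1) ->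
  (forall t w, 0 <= t <= 1 -> root (p t) w ->
     exists2 z, root (p 0) z & cabs (z - w) <= r) ->
  (forall i j : 'I_m, i \in E ->
     cabs ((rootseq (p 0))`_i - (rootseq (p 0))`_j) <= 2 * r -> j \in E) ->
  (m < #|E| + #|F|)%N ->
  exists i j : 'I_m, [/\ i \in E, j \in F &
     cabs ((rootseq (p 0))`_i - (rootseq (p 1))`_j) <= r].
Proof.
move=> p r0 pm near; set zs := rootseq (p 0) => closed EF.
have i0 : 0 <= (0 : R) <= 1 by rewrite lexx ler01.
have i1 : 0 <= (1 : R) <= 1 by rewrite lexx ler01.
have p0 t : 0 <= t <= 1 -> p t != 0.
  by move=> ht; rewrite -size_poly_eq0 (pm t ht).2.
have size_p t : 0 <= t <= 1 -> size (rootseq (p t)) = m.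
  by move=> ht; rewrite size_rootseq ?p0 // (pm t ht).2.
have pE t : 0 <= t <= 1 -> p t = \prod_(z <- rootseq (p t)) ('X - z%:P).
  by move=> ht; rewrite {1}(rootseqE (p t)) (pm t ht).1 scale1r.
have nearI t w : 0 <= t <= 1 -> w \in rootseq (p t) ->
    exists i : 'I_m, cabs (zs`_i - w) <= r.
  move=> ht; rewrite mem_rootseq ?p0 // => /(near t w ht)[z].
  rewrite -mem_rootseq ?p0 // => zz zw.
  have iz : (index z zs < m)%N by rewrite -(size_p 0) // index_mem.
  by exists (Ordinal iz); rewrite /= nth_index.
(* The union of the closed discs of radius [r] around the roots indexed by [E]. *)
pose A w := [exists i in E, cabs (zs`_i - w) <= r].
have [e e0 gap] : exists2 e, 0 < e & forall ij : 'I_m * 'I_m,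
    (ij.1 \in E) && (ij.2 \notin E) -> e < cabs (zs`_ij.1 - zs`_ij.2) - 2 * r.
  apply: finite_gap => -[i j] /= /andP[iE]; apply: contraNT.
  by rewrite -leNgt subr_le0; exact: closed.
(* If [w] were only near a root outside [E], that root would be within [2 * r + e] of one in [E],
   against [gap]. *)
have step s t u w : 0 <= s <= 1 -> 0 <= t <= 1 ->
    u \in rootseq (p s) -> w \in rootseq (p t) -> cabs (u - w) <= e -> A u -> A w.
  move=> hs ht us wt uw /'exists_andP[i [iE iu]].
  have [j jw] := nearI t w ht wt.
  apply/'exists_andP; exists j; split => //; apply/negPn/negP => jE.
  have := gap (i, j); rewrite /= iE jE => /(_ isT).
  have := cabs_triangle u zs`_i zs`_j; have := cabs_triangle w u zs`_j.
  by rewrite (cabsC w); lra.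
pose B := 1 + r + \sum_(z <- zs) cabs z.
have S0 : 0 <= \sum_(z <- zs) cabs z.
  by apply: sumr_ge0 => z _; exact: cabs_ge0.
have B1 : 1 <= B by rewrite /B; lra.
have wB t w : 0 <= t <= 1 -> w \in rootseq (p t) -> cabs w <= B.
  move=> ht /(nearI t w ht)[i iw].
  have ii : zs`_i \in zs by rewrite mem_nth // size_p.
  have zi : cabs zs`_i <= \sum_(z <- zs) cabs z.
    rewrite (big_rem _ ii) /= lerDl.
    by apply: sumr_ge0 => z _; exact: cabs_ge0.
  have := cabs_triangle zs`_i w 0; rewrite !subr0 cabsC /B; lra.
have [d d0 stable] := count_roots_stable m B1 e0.
have [L L0 lip] := poly_path_lipschitz N c.
(* [M.+1] equal steps move each coefficient by at most [d]. *)
have [M Md] : exists M : nat, L < d * M.+1%:R.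
  exists (Num.truncn (L / d)); rewrite mulrC -ltr_pdivrMr //.
  by apply: truncnS_gt.
have MR : (0 : R) < M.+1%:R by rewrite ltr0n.
have frac k : (k <= M.+1)%N -> 0 <= (k%:R / M.+1%:R : R) <= 1.
  move=> kM; rewrite divr_ge0 //= ler_pdivrMr // mul1r ler_nat //.
have const k : (k <= M.+1)%N ->
    count A (rootseq (p (k%:R / M.+1%:R))) = count A zs.
  elim: k => [|k IH] kM; first by rewrite mul0r.
  rewrite -IH; last exact: ltnW.
  have hs := frac _ kM; have ht := frac _ (ltnW kM).
  apply: stable; rewrite ?size_p //.
  - by move=> u; exact: wB.
  - by move=> u; exact: wB.
  - move=> u w us wt uw; apply/idP/idP; first exact: (step _ _ _ _ hs ht us wt uw).
    by apply: (step _ _ _ _ ht hs wt us); rewrite cabsC.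
  move=> j; rewrite -!pE //; apply: le_trans (lip _ _ hs ht j) _.
  rewrite -mulrBl -natrB // subSnn mul1r ger0_norm ?invr_ge0 ?ler0n //.
  by rewrite ler_pdivrMr // ltW.
have := const _ (leqnn _); rewrite divff ?lt0r_neq0 // => cE.
have EA : (#|E| <= count A (rootseq (p 1%R)))%N.
  rewrite cE (count_nth _ (size_p 0 i0)); apply/subset_leq_card/fintype.subsetP => i iE.
  by rewrite inE; apply/'exists_andP; exists i; rewrite subrr cabs0.
(* Without such a pair, [F] avoids the at least $|E|$ indices of roots of [p 1] lying in [A], so
   $|E|+|F| \le m$. *)
apply: contrapT => none.
pose V := [set i : 'I_m | A (rootseq (p 1))`_i].
have cV : count A (rootseq (p 1)) = #|V| := count_nth _ (size_p 1 i1).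
suff : (#|F| <= #|~: V|)%N.
  by have := cardsC V; rewrite card_ord -cV; move: EF EA; lia.
apply/subset_leq_card/fintype.subsetP => j jF; rewrite !inE; apply/negP.
move=> /'exists_andP[i [iE ij]]; apply: none; exists i, j.
by split.
Qed.

(** While [E] is not closed under distance [2 * r], a neighbour is adjoined at cost [2 * r]. This
    happens at most $m-|E|$ times, and the closed set costs a last [r]. *)
Lemma chain_distance (R : realType) m (r : R) (z w : 'I_m -> R[i]) (F : {set 'I_m}) :
  0 <= r ->
  (forall E : {set 'I_m},
     (forall i j, i \in E -> cabs (z i - z j) <= 2 * r -> j \in E) ->
     (m < #|E| + #|F|)%N ->
     exists i j, [/\ i \in E, j \in F & cabs (z i - w j) <= r]) ->
  forall E : {set 'I_m}, (m < #|E| + #|F|)%N ->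
  exists i j, [/\ i \in E, j \in F &
    cabs (z i - w j) <= (2 * (m - #|E|) + 1)%:R * r].
Proof.
move=> r0 base E; have [k] := ubnP (m - #|E|); elim: k E => // k IH E Ek EF.
have [closed|] := pselect (forall i j, i \in E -> cabs (z i - z j) <= 2 * r -> j \in E).
  have [i [j [iE jF ij]]] := base E closed EF; exists i, j; split => //.
  by apply: le_trans ij _; rewrite ler_peMl // ler1n addn1.
move=> /existsNP[i /existsNP[j /not_implyP[iE /not_implyP[ij /negP jE]]]].
have cj : #|j |: E| = #|E|.+1 by rewrite cardsU1 jE.
have Em : (#|E|.+1 <= m)%N.
  by rewrite -cj -[leqRHS](card_ord m) max_card.
have [||a [b [aE bF ab]]] := IH (j |: E); rewrite ?cj; [by lia..|].
have le2 : cabs (z a - w b) + 2 * r <= (2 * (m - #|E|) + 1)%:R * r.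
  apply: le_trans (lerD ab (lexx _)) _; rewrite cj -mulrDl ler_wpM2r //.
  by rewrite -natrD ler_nat; lia.
(* If the pair found starts at the adjoined [j], it is rerouted through [i]. *)
move: aE; rewrite !inE => /orP[/eqP aj|aE]; last by exists a, b; split => //; lra.
exists i, b; split => //; apply: le_trans le2; rewrite aj.
by have := cabs_triangle (z j) (z i) (w b); lra.
Qed.

(** * Products of first-order factors *)

Lemma lead_size_subderiv (R : realType) (g : R[i]) (f : {poly R[i]}) :
  lead_coef (subderiv g f) = lead_coef f /\ size (subderiv g f) = size f.
Proof.
have [->|f0] := eqVneq f 0; first by rewrite /subderiv derivC scaler0 subr0.
have H : (size (- (g *: f^`())) < size f)%N.
  rewrite size_polyN; apply: leq_ltn_trans (size_scale_leq _ _) _.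
  exact: lt_size_deriv.
by rewrite lead_coefDl // size_polyDl.
Qed.

Lemma subderivZ (R : realType) (g c : R[i]) (f : {poly R[i]}) :
  subderiv g (c *: f) = c *: subderiv g f.
Proof. by rewrite /subderiv derivZ scalerBr !scalerA mulrC. Qed.

Lemma derivn_large (R : realType) (f : {poly R[i]}) k :
  (size f <= k)%N -> f^`(k) = 0.
Proof.
move=> fk; apply/polyP => i; rewrite coef_derivn coef0 nth_default ?mul0rn //.
by rewrite (leq_trans fk) // leq_addr.
Qed.

(** With the next lemma: the truncated geometric series inverts $I - aD$ on either side, up to a
    remainder that vanishes once [N] reaches the size of [f]. *)
Lemma subderiv_sum_derivn (R : realType) (a : R[i]) (f : {poly R[i]}) N :
  subderiv a (\sum_(k < N) a ^+ k *: f^`(k)) = f - a ^+ N *: f^`(N).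
Proof.
rewrite /subderiv; elim: N => [|N IH].
  by rewrite big_ord0 derivC scaler0 expr0 scale1r derivn0 !subrr.
rewrite big_ord_recr /= derivD scalerDr opprD addrACA IH derivZ -derivnS scalerA.
by rewrite -exprS subrKA.
Qed.

Lemma sum_derivn_subderiv (R : realType) (a : R[i]) (f : {poly R[i]}) N :
  \sum_(k < N) a ^+ k *: (subderiv a f)^`(k) = f - a ^+ N *: f^`(N).
Proof.
elim: N => [|N IH]; first by rewrite big_ord0 expr0 scale1r derivn0 subrr.
rewrite big_ord_recr /= IH /subderiv derivnB derivnZ -derivSn scalerBr scalerA.
by rewrite -exprSr subrKA.
Qed.

(** A bound on $d_F$ in a form that composes. [m] is meant to be the common number of roots, as
    indexing beyond a list yields [0]. *)
Definition root_matching (R : realType) (rho : R) m (f g : {poly R[i]}) :=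
  exists s : 'I_m -> 'I_m, injective s /\
    forall i : 'I_m, cabs ((rootseq f)`_i - (rootseq g)`_(s i)) <= rho.

Lemma root_matching_trans (R : realType) (rho sigma : R) m (f g h : {poly R[i]}) :
  root_matching rho m f g -> root_matching sigma m g h ->
  root_matching (rho + sigma) m f h.
Proof.
move=> [s [si sP]] [t [ti tP]]; exists (t \o s); split; first exact: inj_comp.
move=> i; apply: le_trans (cabs_triangle (rootseq g)`_(s i) _ _) _.
by rewrite lerD //= tP.
Qed.

Lemma root_matchingZ (R : realType) (rho : R) m (c : R[i]) (f g : {poly R[i]}) :
  c != 0 -> root_matching rho m (c *: f) (c *: g) -> root_matching rho m f g.
Proof. by move=> c0; rewrite /root_matching !rootseqZ. Qed.

(* The graph of pairs at distance at most [rho] fails to have a perfect matching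
   only if sets [E], [F] with [#|E| + #|F| > m] are at distance more than [rho].
   The paths [subderiv (t g) f] and [(1 - t g D)^-1 (subderiv g f)] bound that
   distance by [(2 (m - #|E|) + 1) r] and [(2 (m - #|F|) + 1) r], one of which
   is at most [m r]. *)
Lemma subderiv_matching_monic (R : realType) n m (g : R[i]) (f : {poly R[i]}) :
  (m <= n)%N -> size f = m.+1 -> lead_coef f = 1 ->
  root_matching ((n ^ 2)%:R * cabs g) m f (subderiv g f).
Proof.
move=> mn sf f1; set h := subderiv g f; set r : R := n%:R * cabs g.
have r0 : 0 <= r by rewrite mulr_ge0 ?cabs_ge0.
have [h1 sh] : lead_coef h = 1 /\ size h = m.+1.
  by rewrite /h; have [-> ->] := lead_size_subderiv g f.
have nz (p : {poly R[i]}) : size p = m.+1 -> p != 0.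
  by move=> sp; rewrite -size_poly_eq0 sp.
have tr t : 0 <= t <= 1 -> n%:R * cabs (t%:C%C * g) <= r.
  move=> /andP[t0 t1]; rewrite ler_wpM2l // cabsM cabs_real //.
  by rewrite ler_piMl ?cabs_ge0.
pose c1 k := if k == 0%N then f else - g *: f^`().
have p1E t : poly_path 2 c1 t = subderiv (t%:C%C * g) f.
  rewrite /poly_path !big_ord_recl big_ord0 /c1 /= expr0 scale1r expr1 addr0.
  by rewrite scalerA mulrN scaleNr.
have p10 : poly_path 2 c1 0 = f by rewrite p1E /subderiv mul0r scale0r subr0.
have p11 : poly_path 2 c1 1 = h by rewrite p1E mul1r.
(* The path $(1-tgD)^{-1}h$, from [h] back to [f]; [m.+1] terms suffice since [h] has degree [m]. *)
pose c2 k := g ^+ k *: h^`(k).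
have p2E t : poly_path m.+1 c2 t = \sum_(k < m.+1) (t%:C%C * g) ^+ k *: h^`(k).
  by apply: eq_bigr => k _; rewrite /c2 scalerA rmorphXn exprMn.
have p2L t : subderiv (t%:C%C * g) (poly_path m.+1 c2 t) = h.
  by rewrite p2E subderiv_sum_derivn derivn_large ?sh // scaler0 subr0.
have p20 : poly_path m.+1 c2 0 = h.
  by rewrite -[RHS](p2L 0) /subderiv mul0r scale0r subr0.
have p21 : poly_path m.+1 c2 1 = f.
  by rewrite p2E mul1r sum_derivn_subderiv derivn_large ?sf // scaler0 subr0.
pose e (i j : 'I_m) :=
  cabs ((rootseq f)`_i - (rootseq h)`_j) <= (n ^ 2)%:R * cabs g.
have [[s [si sP]]|[E [F [EF far]]]] := matching_or_obstruction e; first by exists s.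
exfalso.
have [i [j [iE jF d]]] : exists i j : 'I_m, [/\ i \in E, j \in F &
    cabs ((rootseq f)`_i - (rootseq h)`_j) <= (2 * (m - #|E|) + 1)%:R * r].
  apply: (@chain_distance R m r (fun i => (rootseq f)`_i)
    (fun j => (rootseq h)`_j)) => // E' closed EF'.
  have := @homotopy_count R 2 c1 m r E' F; rewrite /= p10 p11; apply=> //.
    by move=> t _; rewrite p1E; have [-> ->] := lead_size_subderiv (t%:C%C * g) f.
  move=> t w ht; rewrite p1E => rw.
  have [||z fz zw] := subderiv_root_near (n := n) _ _ rw; rewrite ?sf ?nz //.
  by exists z => //; exact: le_trans (tr t ht).
have [j' [i' [jF' iE' d']]] : exists j i : 'I_m, [/\ j \in F, i \in E &
    cabs ((rootseq h)`_j - (rootseq f)`_i) <= (2 * (m - #|F|) + 1)%:R * r].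
  apply: (@chain_distance R m r (fun j => (rootseq h)`_j)
    (fun i => (rootseq f)`_i)) => //; last by rewrite addnC.
  move=> F' closed FE.
  have s2 t : lead_coef (poly_path m.+1 c2 t) = 1 /\ size (poly_path m.+1 c2 t) = m.+1.
    by have [<- <-] := lead_size_subderiv (t%:C%C * g) (poly_path m.+1 c2 t); rewrite p2L.
  have := @homotopy_count R m.+1 c2 m r F' E; rewrite /= p20 p21; apply=> //.
  move=> t w ht rw; have [_ st] := s2 t.
  (* The path polynomial is sent to [h] by $1-tgD$, so the converse estimate places its roots near
     those of [h]. *)
  have [||z fz zw] := subderiv_root_near_conv (n := n) (t%:C%C * g) _ _ rw.
  - by rewrite st.
  - exact: nz.
  by exists z; [rewrite p2L in fz|rewrite cabsC; exact: le_trans (tr t ht)].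
have bound k : (k <= m)%N -> k%:R * r <= (n ^ 2)%:R * cabs g.
  move=> km; rewrite /r mulrA ler_wpM2r ?cabs_ge0 // -natrM ler_nat.
  by rewrite -mulnn leq_mul // (leq_trans km).
(* As $|E|+|F| \ge m+1$, the two factors add up to at most $2m$, so one is at most [m]. *)
have [EF'|FE] := leqP (2 * (m - #|E|) + 1)%N m.
  by have := far i j iE jF; rewrite /e (le_trans d) // bound.
have Xm (X : {set 'I_m}) : (#|X| <= m)%N.
  by rewrite -[leqRHS](card_ord m) max_card.
have FE' : (2 * (m - #|F|) + 1 <= m)%N by move: EF FE (Xm E) (Xm F); lia.
by have := far i' j' iE' jF'; rewrite /e cabsC (le_trans d') // bound.
Qed.

Lemma subderiv_matching (R : realType) n m (g : R[i]) (f : {poly R[i]}) :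
  (m <= n)%N -> size f = m.+1 ->
  root_matching ((n ^ 2)%:R * cabs g) m f (subderiv g f).
Proof.
move=> mn sf.
have l0 : lead_coef f != 0 by rewrite lead_coef_eq0 -size_poly_eq0 sf.
apply: (@root_matchingZ _ _ _ (lead_coef f)^-1); first by rewrite invr_eq0.
rewrite -subderivZ; apply: subderiv_matching_monic => //.
  by rewrite size_scale // invr_eq0.
by rewrite lead_coefZ mulVf.
Qed.

Lemma size_foldr_subderiv (R : realType) (gs : seq R[i]) (f : {poly R[i]}) :
  size (foldr (@subderiv R) f gs) = size f.
Proof.
by elim: gs => //= g gs IH; rewrite (lead_size_subderiv g _).2.
Qed.

Lemma foldr_subderiv_eq0 (R : realType) (gs : seq R[i]) (f : {poly R[i]}) :
  (foldr (@subderiv R) f gs == 0) = (f == 0).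
Proof. by rewrite -!size_poly_eq0 size_foldr_subderiv. Qed.

Lemma foldr_subderiv_root_near (R : realType) n (gs : seq R[i]) (f : {poly R[i]}) w :
  (size f <= n.+1)%N -> f != 0 -> root (foldr (@subderiv R) f gs) w ->
  exists2 z, root f z & cabs (z - w) <= n%:R * \sum_(g <- gs) cabs g.
Proof.
move=> sf f0; elim: gs w => [|g gs IH] w /= rw.
  by exists w => //; rewrite subrr cabs0 big_nil mulr0.
have [||v rv vw] := subderiv_root_near (n := n) _ _ rw.
- by rewrite size_foldr_subderiv.
- by rewrite foldr_subderiv_eq0.
have [z fz zv] := IH v rv; exists z => //.
apply: le_trans (cabs_triangle v _ _) _.
by rewrite big_cons mulrDr addrC lerD.
Qed.

Lemma foldr_subderiv_root_near_conv (R : realType) n (gs : seq R[i]) (f : {poly R[i]}) z :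
  (size f <= n.+1)%N -> f != 0 -> root f z ->
  exists2 w, root (foldr (@subderiv R) f gs) w
     & cabs (w - z) <= n%:R * \sum_(g <- gs) cabs g.
Proof.
move=> sf f0 fz; elim: gs => [|g gs [v rv vz]] /=.
  by exists z => //; rewrite subrr cabs0 big_nil mulr0.
have [||w rw vw] := subderiv_root_near_conv (n := n) g _ _ rv.
- by rewrite size_foldr_subderiv.
- by rewrite foldr_subderiv_eq0.
exists w => //; apply: le_trans (cabs_triangle v _ _) _.
by rewrite big_cons mulrDr lerD // cabsC.
Qed.

Lemma foldr_subderiv_matching (R : realType) n m (gs : seq R[i]) (f : {poly R[i]}) :
  (m <= n)%N -> size f = m.+1 ->
  root_matching ((n ^ 2)%:R * \sum_(g <- gs) cabs g) m f (foldr (@subderiv R) f gs).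
Proof.
move=> mn sf; elim: gs => [|g gs IH] /=.
  by exists id; split => // i; rewrite subrr cabs0 big_nil mulr0.
rewrite big_cons mulrDr addrC; apply: root_matching_trans IH _.
by apply: subderiv_matching => //; rewrite size_foldr_subderiv.
Qed.

(** Expanding $\prod_g (1-gD)$ gives the coefficients of $\prod_g (X-g)$ in reverse order. *)
Lemma foldr_subderivE (R : realType) (gs : seq R[i]) (f : {poly R[i]}) :
  foldr (@subderiv R) f gs =
  \sum_(k < (size gs).+1) (\prod_(g <- gs) ('X - g%:P))`_(size gs - k) *: f^`(k).
Proof.
elim: gs => [|g gs IH] /=.
  by rewrite big_ord1 big_nil subnn coef1 scale1r derivn0.
rewrite {}IH big_cons; set q := \prod_(_ <- _) _; set m := size gs.
under [RHS]eq_bigr do rewrite mulrBl coefB coefXM coefCM scalerBl.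
(* The two boundary terms vanish: the constant coefficient of ['X * q], and the coefficient of [q]
   beyond its degree. *)
rewrite sumrB /= [X in _ = X - _]big_ord_recr /= subnn /= scale0r addr0.
rewrite [X in _ = _ - X]big_ord_recl /= subn0 [q`_m.+1]nth_default; last first.
  by rewrite size_prod_XsubC.
rewrite mulr0 scale0r add0r /subderiv; congr (_ - _).
  by apply: eq_bigr => -[k /= km] _; rewrite subSn.
rewrite raddf_sum scaler_sumr; apply: eq_bigr => -[k /= km] _.
by rewrite derivZ -derivnS scalerA.
Qed.

(** As [a 0] is nonzero, it leads the symbol, which thus has exactly [n] roots; its coefficients in
    reverse order are those of [T]. *)
Lemma Top_factor (R : realType) n (a : nat -> R[i]) (f : {poly R[i]}) :
  a 0%N != 0 ->
  Top n a f = a 0%N *: foldr (@subderiv R) f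
    (rootseq (\sum_(k < n.+1) a k *: 'X^(n - k))).
Proof.
move=> a0; set P := \sum_(_ < _) _.
have Pk k : (k <= n)%N -> P`_(n - k) = a k.
  move=> kn; rewrite coef_sum (bigD1 (Ordinal (kn : (k < n.+1)%N))) //=.
  rewrite coefZ coefXn eqxx mulr1 big1 ?addr0 // => -[j /= jn] jk.
  rewrite coefZ coefXn; case: eqP => [E|]; last by rewrite mulr0.
  by case/eqP: jk; apply: val_inj => /=; lia.
have sP : (size P <= n.+1)%N.
  apply/leq_sizeP => j nj; rewrite coef_sum big1 // => -[k /= kn] _.
  by rewrite coefZ coefXn; case: eqP => [E|]; [lia|rewrite mulr0].
have Pn : P`_n = a 0%N by rewrite -(Pk 0%N) // subn0.
have sPn : size P = n.+1.
  apply/eqP; rewrite eqn_leq sP ltnNge; apply/negP => H.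
  by move: a0; rewrite -Pn nth_default // eqxx.
have P0 : P != 0 by rewrite -size_poly_eq0 sPn.
have PE : P = a 0%N *: \prod_(g <- rootseq P) ('X - g%:P).
  by rewrite {1}(rootseqE P) lead_coefE sPn Pn.
rewrite foldr_subderivE size_rootseq // sPn /Top scaler_sumr.
apply: eq_bigr => -[k /= kn] _; rewrite scalerA -coefZ -PE Pk //.
Qed.

(** * From root estimates to the three distances *)

Lemma dF_le (R : realType) (rho : R) (f g : {poly R[i]}) m :
  0 <= rho -> size (rootseq f) = m -> size (rootseq g) = m ->
  root_matching rho m f g -> dF (rootseq f) (rootseq g) <= rho.
Proof.
move=> rho0 sf sg [s [si sP]]; rewrite /dF.
(* The roots of [g] in matched order: one of the permutations over which [dF] minimises. *)
pose t := [seq (rootseq g)`_(s i) | i <- enum 'I_m].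
have tm : perm_eq t (rootseq g).
  have -> : rootseq g = [seq (rootseq g)`_(i : 'I_m) | i <- enum 'I_m].
    apply: (@eq_from_nth _ 0); first by rewrite size_map size_enum_ord sg.
    move=> i; rewrite sg => im.
    by rewrite (nth_map (Ordinal im)) ?size_enum_ord // nth_enum_ord.
  have -> : t = [seq (rootseq g)`_(i : 'I_m) | i <- map s (enum 'I_m)].
    by rewrite -map_comp.
  apply: perm_map; apply: uniq_perm; rewrite ?(map_inj_uniq si) ?enum_uniq //.
  move=> i; rewrite mem_enum inE; apply/mapP.
  have [s' _ s'K] := injF_bij si.
  by exists (s' i); rewrite ?mem_enum ?s'K.
have mt : maxdiff (rootseq f) t <= rho.
  apply: bigmax_le => // -[i im] _ /=; have im' : (i < m)%N by rewrite -sf.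
  rewrite (nth_map (Ordinal im')) ?size_enum_ord //.
  by have := sP (Ordinal im'); rewrite (nth_ord_enum _ (Ordinal im')).
have : t \in permutations (rootseq g) by rewrite mem_permutations.
elim: (permutations _) => //= v vs IH; rewrite inE => /orP[/eqP <-|/IH H].
  by rewrite ge_min mt.
by rewrite ge_min H orbT.
Qed.

(** Equal sizes make both lists empty or both nonempty, which excludes the infinite values. *)
Lemma dh_fin_le (R : realType) (rho : R) (A B : seq R[i]) :
  0 <= rho -> size A = size B ->
  (forall y, y \in B -> exists2 x, x \in A & cabs (x - y) <= rho) ->
  (dh_fin A B <= rho%:E)%E.
Proof.
move=> rho0 AB near.
have bound : \big[Num.max/0]_(y <- B) mindist A y <= rho.
  rewrite big_seq; apply: bigmax_le => // y /near[x xA xy]; rewrite /mindist.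
  (* The starting value of the fold in [mindist] is generalised, since it depends on the list. *)
  elim: A xA (cabs _) {AB near} => //= v vs IH; rewrite inE => /orP[/eqP <-|/IH H] d.
    by rewrite ge_min xy.
  by rewrite ge_min H orbT.
by case: A B AB bound {near} => [|x A] [|y B] //= _; rewrite lee_fin.
Qed.

Theorem mainTheorem3 (R : realType) (n : nat) (a : nat -> R[i]) :
  (1 <= n)%N -> a 0%N != 0 ->
  let T := Top n a in
  let gammas := rootseq (\sum_(k < n.+1) a k *: 'X^(n - k)) in
  let S := \sum_(g <- gammas) cabs g in
  (forall f : {poly R[i]}, inPn n f -> size (T f) = size f) /\
  (Kh n T <= (n%:R * S)%:E)%E /\
  (KH n T <= (n%:R * S)%:E)%E /\
  (KF n T <= ((n ^ 2)%:R * S)%:E)%E.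
Proof.
move=> _ a0 T gammas S.
have TE f : T f = a 0%N *: foldr (@subderiv R) f gammas := Top_factor n f a0.
have sT f : size (T f) = size f by rewrite TE size_scale // size_foldr_subderiv.
have S0 : 0 <= S by apply: sumr_ge0 => g _; exact: cabs_ge0.
have nS0 : 0 <= n%:R * S by rewrite mulr_ge0.
have T0 f : (T f == 0) = (f == 0) by rewrite -!size_poly_eq0 sT.
have near f w : inPn n f -> f != 0 -> w \in rootseq (T f) ->
    exists2 z, z \in rootseq f & cabs (z - w) <= n%:R * S.
  move=> fn f0; rewrite TE rootseqZ // mem_rootseq ?foldr_subderiv_eq0 // => rw.
  have [z fz zw] := foldr_subderiv_root_near fn f0 rw.
  by exists z; rewrite ?mem_rootseq.
have near_conv f z : inPn n f -> f != 0 -> z \in rootseq f ->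
    exists2 w, w \in rootseq (T f) & cabs (w - z) <= n%:R * S.
  move=> fn f0; rewrite mem_rootseq // => fz.
  have [w rw wz] := foldr_subderiv_root_near_conv gammas fn f0 fz.
  by exists w; rewrite // TE rootseqZ // mem_rootseq ?foldr_subderiv_eq0.
have dh_le f : inPn n f -> (dh (Zset f) (Zset (T f)) <= (n%:R * S)%:E)%E.
  (* For [f = 0] both root sets are the whole plane, at distance [0]. *)
  move=> fn; rewrite /Zset T0; case: eqVneq => [_|f0] /=; first by rewrite lee_fin.
  apply: dh_fin_le => //; first by rewrite !size_rootseq ?T0 ?sT.
  by move=> w; exact: near.
have dh_conv_le f : inPn n f -> (dh (Zset (T f)) (Zset f) <= (n%:R * S)%:E)%E.
  move=> fn; rewrite /Zset T0; case: eqVneq => [_|f0] /=; first by rewrite lee_fin.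
  apply: dh_fin_le => //; first by rewrite !size_rootseq ?T0 ?sT.
  by move=> w; exact: near_conv.
split; first by move=> f _; exact: sT.
split; first by apply: ge_ereal_sup => _ [f /= fn <-]; exact: dh_le.
split.
  apply: ge_ereal_sup => _ [f /= fn <-].
  by rewrite /dH ge_max dh_le //= dh_conv_le.
apply: ge_ereal_sup => _ [f /= [fn f1] <-]; rewrite lee_fin.
have f0 : f != 0 by rewrite -size_poly_gt0 ltnW.
have sf : size f = (size f).-1.+1 by rewrite prednK // ltnW.
apply: (@dF_le _ _ _ _ (size f).-1); rewrite ?size_rootseq ?T0 ?sT //.
  by rewrite mulr_ge0.
rewrite /root_matching TE rootseqZ //; apply: foldr_subderiv_matching (sf).
by rewrite -ltnS -sf.
Qed.
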